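(* For $e\ge 2$, the group $\mathrm{ASL}_2(2^e)$ of affine transformations of $X=\mathbb{F}_{2^e}^2$ does not have the strict-EKR property.
   Context: $\mathrm{ASL}_2(q)$ is the group of permutations of $\mathbb{F}_q^2$ of the form $x\mapsto Ax+v$ with $A\in\mathrm{SL}_2(q)$, $v\in\mathbb{F}_q^2$. For a permutation group $G$ on $X$, two elements $g,h$ intersect if $i^g=i^h$ for some $i\in X$; a maximum intersecting set is a set of pairwise intersecting elements of largest possible size. The canonical intersecting sets are $S_{i,j}=\{g\in G: i^g=j\}$, $i,j\in X$. $G$ has the strict-EKR property if the canonical intersecting sets are exactly the maximum intersecting sets (i.e., they are maximum and there are no others). *)

(* Defs.v *)
From HB Require Import structures.
From mathcomp Require Import all_boot all_order all_algebra all_fingroup.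

Set Implicit Arguments.
Unset Strict Implicit.
Unset Printing Implicit Defensive.

Import GRing.Theory.

Section EKR.

Variable X : finType.
Implicit Types (g h : {perm X}) (G S T : {set {perm X}}) (i j : X).

Definition intersect g h : Prop := exists i : X, g i = h i.

Definition intersecting_set G S : Prop :=
  S \subset G /\ {in S &, forall g h, intersect g h}.

Definition maximum_intersecting_set G S : Prop :=
  intersecting_set G S /\
  forall T, intersecting_set G T -> #|T| <= #|S|.

Definition canonical_set G i j : {set {perm X}} := [set g in G | g i == j].

Definition strict_EKR (G : {group {perm X}}) : Prop :=
  forall S, maximum_intersecting_set G S <-> exists i j, S = canonical_set G i j.

End EKR.

Section ASL2.

Local Open Scope ring_scope.

Variable F : finFieldType.

Definition ASL2 : {set {perm 'cV[F]_2}} :=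
  [set g : {perm 'cV[F]_2} | [exists A : 'M[F]_2, exists v : 'cV[F]_2,
     (\det A == 1) && [forall x : 'cV[F]_2, g x == A *m x + v]]].

Lemma ASL2P (g : {perm 'cV[F]_2}) :
  reflect (exists A : 'M[F]_2, exists v : 'cV[F]_2,
             \det A = 1 /\ forall x, g x = A *m x + v)
          (g \in ASL2).
Proof.
rewrite inE; apply: (iffP existsP).
  case=> A /existsP[v /andP[/eqP dA /forallP gE]]; exists A, v.
  by split=> // x; apply/eqP.
case=> A [v [dA gE]]; exists A; apply/existsP; exists v.
by rewrite dA eqxx; apply/forallP=> x; rewrite gE.
Qed.

Lemma group_set_ASL2 : group_set ASL2.
Proof.
apply/group_setP; split.
  apply/ASL2P; exists 1%:M, 0; split; first exact: det1.
  by move=> x; rewrite perm1 mul1mx addr0.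
move=> g h /ASL2P[A [v [dA gE]]] /ASL2P[B [w [dB hE]]].
apply/ASL2P; exists (B *m A), (B *m v + w).
split; first by rewrite det_mulmx dA dB mulr1.
by move=> x; rewrite permM gE hE mulmxDr mulmxA addrA.
Qed.

Canonical ASL2_group := Group group_set_ASL2.

End ASL2.

Arguments ASL2 F : clear implicits.
Arguments ASL2_group F : clear implicits.

(* Main.v *)
Require Import Defs.
From HB Require Import structures.
From mathcomp Require Import all_boot all_order all_algebra all_fingroup.
From mathcomp Require Import finfield ring.

(** The special linear group acts on quadratic forms in two variables.  In
    characteristic 2 the squares of linear forms span an invariant subspace,
    a Frobenius twist of the natural module, with trivial quotient; untwisting
    gives the cocycle c(A) = (sqrt(ab), sqrt(cd)) for A with rows (a,b) and
    (c,d).  The maps x |-> A x + c(A) form a complement of the translations of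
    the same order as a point stabilizer.  Each of them has a fixed point: this
    is clear if A - 1 is invertible, and otherwise A is an involution, so that
    c(A) lies in Ker (A - 1) = Im (A - 1) unless A = 1.  They therefore
    intersect pairwise, but for q > 2 they have no common fixed point. *)

Section Affine2.

Set Implicit Arguments.
Unset Strict Implicit.
Import GRing.Theory.
Local Open Scope ring_scope.

Variable F : finFieldType.
Implicit Types (A B : 'M[F]_2) (v x : 'cV[F]_2) (g h : {perm 'cV[F]_2}).

(** * Matrices of order 2 and affine maps *)

Lemma ord2P (P : 'I_2 -> Prop) : P 0 -> P 1 -> forall i, P i.
Proof.
move=> P0 P1 [[|[|//]] lt_i2].
  by rewrite (_ : Ordinal _ = 0) //; apply: val_inj.
by rewrite (_ : Ordinal _ = 1) //; apply: val_inj.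
Qed.

Lemma col2_eq v x : v 0 0 = x 0 0 -> v 1 0 = x 1 0 -> v = x.
Proof.
by move=> e0 e1; apply/matrixP=> i j; rewrite (ord1 j); elim/ord2P: i.
Qed.

Lemma sum_ord2 (f : 'I_2 -> F) : \sum_i f i = f 0 + f 1.
Proof.
rewrite !big_ord_recl big_ord0 addr0.
by congr (_ + f _); apply: val_inj.
Qed.

Lemma det_mx2 A : \det A = A 0 0 * A 1 1 - A 0 1 * A 1 0.
Proof.
rewrite (expand_det_row _ 0) sum_ord2 /cofactor !det_mx11 !mxE /=.
have -> : lift 0 0 = 1 :> 'I_2 by apply: val_inj.
have -> : lift 1 0 = 0 :> 'I_2 by apply: val_inj.
by rewrite expr0 expr1; ring.
Qed.

Lemma affine_injective A v : \det A = 1 -> injective (fun x => A *m x + v).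
Proof.
move=> dA x y /addIr /(congr1 (mulmx (invmx A))).
by rewrite !mulKmx // unitmxE dA unitr1.
Qed.

(** Defined for every permutation, so that [twist] needs no matrix as argument; only its values on
    affine maps matter. *)
Definition linear_part g : 'M[F]_2 :=
  \matrix_(i, j) (g (delta_mx j 0) - g 0) i 0.

Lemma linear_partE A v g : (forall x, g x = A *m x + v) -> linear_part g = A.
Proof.
move=> gE; apply/matrixP=> i j.
by rewrite mxE !gE mulmx0 add0r addrK -colE mxE.
Qed.

(** * The square-root cocycle in characteristic 2 *)

Hypothesis pchar2 : 2 \in [pchar F].

Let two0 : 2%:R = 0 :> F. Proof. exact: pcharf0 pchar2. Qed.

Lemma sqr_inj_pchar2 : injective (fun a : F => a ^+ 2).
Proof.
move=> a b /= ab; apply/eqP; rewrite -subr_eq0 -sqrf_eq0; apply/eqP.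
have -> : (a - b) ^+ 2 = (a ^+ 2 - b ^+ 2) + 2%:R * (b ^+ 2 - a * b) by ring.
by rewrite ab subrr two0 mul0r addr0.
Qed.

Definition sqrt2 : F -> F := invF sqr_inj_pchar2.

Lemma sqrt2K a : sqrt2 a ^+ 2 = a.
Proof. exact: (f_invF sqr_inj_pchar2). Qed.

Definition cocycle A : 'cV[F]_2 := \col_i sqrt2 (A i 0 * A i 1).

(** Compare squares: if (a, b) is row i of A, the two entries of row i of A B have product a^2 B00
    B01 + b^2 B10 B11 + a b (B00 B11 + B01 B10), and in characteristic 2 the last bracket is det B =
    1. *)
Lemma cocycleM A B :
  \det B = 1 -> cocycle (A *m B) = cocycle A + A *m cocycle B.
Proof.
rewrite det_mx2 => dB; apply/matrixP=> i j; apply: sqr_inj_pchar2.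
rewrite !mxE !sum_ord2 !mxE sqrt2K.
set a := A i 0; set b := A i 1; set s := sqrt2 (a * b).
set t := sqrt2 _; set u := sqrt2 _.
have -> : (s + (a * t + b * u)) ^+ 2 =
   s ^+ 2 + a ^+ 2 * t ^+ 2 + b ^+ 2 * u ^+ 2
   + 2%:R * (s * a * t + s * b * u + a * t * b * u) by ring.
rewrite !sqrt2K two0 mul0r addr0 -[in RHS](mulr1 (a * b)) -dB.
apply/eqP; rewrite -subr_eq0; apply/eqP.
rewrite -[RHS](mul0r (a * b * B 0 1 * B 1 0)) -two0; ring.
Qed.

Lemma cocycle_fixpoint A : \det A = 1 -> exists x, A *m x + cocycle A = x.
Proof.
move=> dA; pose N := 1%:M - A.
have fixE x : N *m x = cocycle A -> A *m x + cocycle A = x.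
  by move <-; rewrite mulmxBl mul1mx addrC subrK.
have [N0 | Nunit] := eqVneq (\det N) 0; last first.
  exists (invmx N *m cocycle A); apply: fixE.
  by rewrite mulKVmx // unitmxE unitfE.
pose r i j := sqrt2 (A i j).
have rK i j : A i j = r i j ^+ 2 by rewrite sqrt2K.
(* Since det N = 1 - tr A + det A, a singular N forces tr A = 0. *)
have trA : A 0 0 = A 1 1.
  apply/eqP; rewrite -subr_eq0; apply/eqP.
  have -> : A 0 0 - A 1 1 = \det A - 1 - \det N + 2%:R * (1 - A 1 1).
    by rewrite !det_mx2 !mxE /=; ring.
  by rewrite dA N0 two0 mul0r subrr subr0 addr0.
have r11 : r 1 1 = r 0 0 by rewrite /r trA.
(* Once the diagonal entries agree, det A = 1 is the square of this identity. *)
have diagE : 1 + r 0 0 ^+ 2 = r 0 1 * r 1 0.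
  apply: sqr_inj_pchar2; move: dA; rewrite det_mx2 !rK r11 => dA.
  apply/eqP; rewrite -subr_eq0; apply/eqP.
  have -> : (1 + r 0 0 ^+ 2) ^+ 2 - (r 0 1 * r 1 0) ^+ 2 =
      r 0 0 ^+ 2 * r 0 0 ^+ 2 - r 0 1 ^+ 2 * r 1 0 ^+ 2 - 1
      + 2%:R * (1 + r 0 0 ^+ 2) by ring.
  by rewrite dA two0 mul0r subrr addr0.
have cE i : cocycle A i 0 = r i 0 * r i 1.
  by apply: sqr_inj_pchar2; rewrite mxE sqrt2K exprMn -!rK.
have N_E x i : (N *m x) i 0 = (1 *+ (i == 0) + r i 0 ^+ 2) * x 0 0
                            + (1 *+ (i == 1) + r i 1 ^+ 2) * x 1 0.
  by rewrite mxE sum_ord2 !mxE -!rK !(GRing.subr_pchar2 pchar2).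
(* N is the product of the column (r01, r10) and the row (r10, r01), while
   c(A) is r00 times that column: solve r10 x0 + r01 x1 = r00. *)
have [r10 | r10] := eqVneq (r 1 0) 0; last first.
  exists (\col_i (if i == 0 then r 0 0 / r 1 0 else 0)); apply: fixE.
  by apply: col2_eq; rewrite N_E cE !mxE /= ?diagE ?r11; field.
have [r01 | r01] := eqVneq (r 0 1) 0; last first.
  exists (\col_i (if i == 1 then r 0 0 / r 0 1 else 0)); apply: fixE.
  by apply: col2_eq; rewrite N_E cE !mxE /= ?r11 ?diagE ?r10; field.
exists 0; apply: fixE; rewrite mulmx0; apply: col2_eq.
  by rewrite cE mxE r01 mulr0.
by rewrite cE mxE r10 mul0r.
Qed.

(** * The twisted stabilizer *)

Definition twist g := (g * perm (@addrI _ (cocycle (linear_part g))))%g.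

Lemma twistE A g : (forall x, g x = A *m x) ->
  forall x, twist g x = A *m x + cocycle A.
Proof.
move=> gE x; rewrite /twist permM permE gE addrC (@linear_partE A 0) //.
by move=> y; rewrite gE addr0.
Qed.

Definition twisted_stabilizer : {set {perm 'cV[F]_2}} :=
  twist @: canonical_set (ASL2 F) 0 0.

Lemma stabilizer0P g :
  reflect (exists2 A, \det A = 1 & forall x, g x = A *m x)
          (g \in canonical_set (ASL2 F) 0 0).
Proof.
apply: (iffP idP) => [|[A dA gE]].
  rewrite inE => /andP[/ASL2P[A [v [dA gE]]] /eqP g0]; exists A => // x.
  by rewrite gE (_ : v = 0) ?addr0 // -g0 gE mulmx0 add0r.
rewrite inE gE mulmx0 eqxx andbT; apply/ASL2P; exists A, 0; split=> // x.
by rewrite gE addr0.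
Qed.

Lemma twisted_stabilizerP g :
  g \in twisted_stabilizer <->
  exists2 A, \det A = 1 & forall x, g x = A *m x + cocycle A.
Proof.
split=> [/imsetP[h /stabilizer0P[A dA hE] ->] | [A dA gE]].
  by exists A => // x; rewrite (twistE hE).
have hE x : perm (@affine_injective A 0 dA) x = A *m x by rewrite permE addr0.
apply/imsetP; exists (perm (@affine_injective A 0 dA)).
  by apply/stabilizer0P; exists A.
by apply/permP=> x; rewrite gE (twistE hE).
Qed.

(** [twist] is injective on the stabilizer: the image of 0 under the twisted map is the cocycle
    value, and subtracting it recovers the linear map. *)
Lemma card_twisted_stabilizer :
  #|twisted_stabilizer| = #|canonical_set (ASL2 F) 0 0|.
Proof.
apply: card_in_imset => g h /stabilizer0P[A dA gE] /stabilizer0P[B dB hE] ghE.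
have E x : A *m x + cocycle A = B *m x + cocycle B.
  by rewrite -(twistE gE) -(twistE hE) ghE.
have c0 : cocycle A = cocycle B by have := E 0; rewrite !mulmx0 !add0r.
by apply/permP=> x; have := E x; rewrite c0 => /addIr; rewrite gE hE.
Qed.

Lemma intersecting_twisted_stabilizer :
  intersecting_set (ASL2 F) twisted_stabilizer.
Proof.
split.
  apply/subsetP=> g /twisted_stabilizerP[A dA gE].
  by apply/ASL2P; exists A, (cocycle A).
move=> g h /twisted_stabilizerP[A dA gE] /twisted_stabilizerP[B dB hE].
have Au : A \in unitmx by rewrite unitmxE dA unitr1.
have dC : \det (invmx A *m B) = 1 by rewrite det_mulmx det_inv dA dB invr1 mul1r.
(* With C = A^-1 B, the cocycle rule gives B x + c(B) = A (C x + c(C)) + c(A), so a fixed point of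
   the twist of C is a point where g and h agree. *)
have [x xE] := cocycle_fixpoint dC; exists x.
rewrite gE hE -(mulKVmx Au B) cocycleM // -{1}xE mulmxDr !mulmxA.
by rewrite -!addrA [cocycle A + _]addrC.
Qed.

Lemma twisted_stabilizer_not_canonical i j :
  (2 < #|F|)%N -> twisted_stabilizer <> canonical_set (ASL2 F) i j.
Proof.
move=> cardF defS.
have mapsE A : \det A = 1 -> A *m i + cocycle A = j.
  move=> dA; pose g := perm (@affine_injective A (cocycle A) dA).
  have : g \in canonical_set (ASL2 F) i j.
    by rewrite -defS; apply/twisted_stabilizerP; exists A => // x; rewrite permE.
  by rewrite inE permE => /andP[_ /eqP].
have mapsE2 a b c d : a * d - b * c = 1 ->
    a * i 0 0 + b * i 1 0 + sqrt2 (a * b) = j 0 0 /\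
    c * i 0 0 + d * i 1 0 + sqrt2 (c * d) = j 1 0.
  move=> abcd; pose A : 'M[F]_2 := \matrix_(k, l)
    if k == 0 then if l == 0 then a else b else if l == 0 then c else d.
  have /mapsE/matrixP E : \det A = 1 by rewrite det_mx2 !mxE.
  by move: (E 0 0) (E 1 0); rewrite !mxE !sum_ord2 !mxE.
have sqrt20 : sqrt2 0 = 0 by apply: sqr_inj_pchar2; rewrite sqrt2K expr0n.
have sqrt21 : sqrt2 1 = 1 by apply: sqr_inj_pchar2; rewrite sqrt2K expr1n.
have [a _] : exists2 a, a \in [set: F] & a \notin [set 0; 1].
  apply/subsetPn; apply: contraL cardF => /subset_leq_card.
  by rewrite cardsT cards2 eq_sym oner_eq0 -leqNgt.
rewrite !inE negb_or => /andP[a0 a1].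
(* The identity gives i = j, the transvection then gives i1 = 1 for the second coordinate of i, and
   diag(a, a^-1) gives a^-1 i1 = i1, against a <> 1. *)
have [] := mapsE2 1 0 0 1; first by ring.
have [] := mapsE2 1 1 0 1; first by ring.
have [] := mapsE2 a 0 0 a^-1; first by field.
rewrite !(mulr0, mul0r, mulr1, mul1r, addr0, add0r) sqrt20 sqrt21 !addr0.
move=> _ D1 U0 _ I0 I1.
have i1 : i 1 0 + 1 = 0 by apply: (addrI (i 0 0)); rewrite addr0 addrA U0.
have {i1} i1 : i 1 0 = 1.
  by rewrite -(GRing.oppr_pchar2 pchar2 1); apply/eqP; rewrite -addr_eq0 i1.
by case/eqP: a1; apply: invr_inj; rewrite invr1 -[LHS]mulr1 -i1 D1 -I1.
Qed.

Lemma not_strict_EKR_ASL2 : (2 < #|F|)%N -> ~ strict_EKR (ASL2_group F).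
Proof.
move=> cardF sEKR.
(* Strict EKR itself supplies the maximality of the stabilizer of 0, which passes to the twisted
   stabilizer by equality of orders. *)
have [_ max0] : maximum_intersecting_set (ASL2 F) (canonical_set (ASL2 F) 0 0).
  by apply/sEKR; exists 0, 0.
have /sEKR[i [j defS]] : maximum_intersecting_set (ASL2 F) twisted_stabilizer.
  split; first exact: intersecting_twisted_stabilizer.
  by move=> T /max0; rewrite card_twisted_stabilizer.
exact: twisted_stabilizer_not_canonical defS.
Qed.

End Affine2.

Theorem theorem6p2 (e : nat) (F : finFieldType) (he : 2 <= e)
  (hF : #|F| = 2 ^ e) :
  ~ strict_EKR (ASL2_group F).
Proof.
apply: not_strict_EKR_ASL2; first exact: (card_finPcharP hF).
by rewrite hF (ltn_exp2l 1).
Qed.
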